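(* Let $0<m<n$, $s:=n-m$, $\mathbb{G}:=\mathbb{G}(s,\mathbb{P}^n)$, and let $Z\subseteq\mathbb{P}^n$ be an $m$-dimensional irreducible complex projective variety. For $0<\varepsilon\le1$ we have $$\{L\in\mathbb{G}\mid\kappa_Z(L)\ge\varepsilon^{-1}\}\ \subseteq\ T(\Sigma(Z),\varepsilon)\cup\mathrm{Irrel}(Z).$$
   Context: Metrics. $\mathbb{C}^{n+1}$ carries its standard hermitian inner product $\langle\cdot,\cdot\rangle$. The tangent space of $\mathbb{P}^n=\mathbb{P}^n(\mathbb{C})$ at the point represented by $z\in\mathbb{C}^{n+1}\setminus\{0\}$ is modelled as $T_z\mathbb{P}^n=\{\dot z\in\mathbb{C}^{n+1}\mid\langle\dot z,z\rangle=0\}$ with hermitian inner product $\langle\dot u,\dot v\rangle_z=\|z\|^{-2}\langle\dot u,\dot v\rangle$ (Fubini-Study metric). $\mathbb{G}=\mathbb{G}(s,\mathbb{P}^n)$ is the complex Grassmann manifold of $s$-dimensional projective linear subspaces $L\subseteq\mathbb{P}^n$, identified with the Grassmann manifold $\mathbb{G}(s+1,\mathbb{C}^{n+1})$ of $(s+1)$-dimensional linear subspaces $\widehat L\subseteq\mathbb{C}^{n+1}$ (with $L=\mathbb{P}(\widehat L)$). Its hermitian metric is the unitarily invariant one: identifying $T_L\mathbb{G}$ with $\mathrm{Hom}(\widehat L,\widehat L^\perp)$ and writing linear maps as matrices $R,S$ in orthonormal bases, $\langle R,S\rangle=\mathrm{tr}(RS^* )$. $d_g$ denotes the geodesic distance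 on $\mathbb{G}$ for the Riemannian metric given by the real part of this hermitian metric. Local condition number. For a smooth point $z$ of $Z$ and $L\in\mathbb{G}$ with $z\in L$, the intersection is transversal at $z$ if $T_zZ+T_zL=T_z\mathbb{P}^n$. In this case there are open neighborhoods $U$ of $L$ in $\mathbb{G}$ and $V$ of $z$ in $Z$ and a holomorphic map $\gamma\colon U\to V$ with $\tilde L\cap V=\{\gamma(\tilde L)\}$ for all $\tilde L\in U$, and $\kappa_Z(L,z):=\|D_L\gamma\|$ is the operator norm of $D_L\gamma\colon T_L\mathbb{G}\to T_z\mathbb{P}^n$ with respect to the hermitian norm on $T_L\mathbb{G}$ and the Fubini-Study norm on $T_z\mathbb{P}^n$. If $z\in Z\cap L$ is not a smooth point of $Z$ or the intersection at $z$ is not transversal, $\kappa_Z(L,z):=\infty$. Global notions. $\mathrm{Irrel}(Z)$ is the set of $L\in\mathbb{G}$ such that $\mathrm{Sing}(Z)\cap L\neq\emptyset$ or $Z\cap L$ has positive dimension. For $L\in\mathbb{G}\setminus\mathrm{Irrel}(Z)$, $\kappa_Z(L):=\max_{z\in Z\cap L}\kappa_Z(L,z)$; for $L\in\mathrm{Irrel}(Z)$, $\kappa_Z(L):=\infty$. For a smooth point $z$ of $Z$, the local Schubert variety is $\Sigma_z(Z):=\{L\in\mathbb{G}\mid z\in L,\ T_zZ\cap T_zL\neq0\}$. The Hurwitz variety $\Sigma(Z)$ is the Zariski closure in $\mathbb{G}$ of the union of the $\Sigma_z(Z)$ over all smooth points $z$ of $Z$. Put $d_g(L,\Sigma(Z)):=\min\{d_g(L,L')\mid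 L'\in\Sigma(Z)\}$ and $T(\Sigma(Z),\varepsilon):=\{L\in\mathbb{G}\mid d_g(L,\Sigma(Z))\le\arcsin\varepsilon\}$. *)

(* Defs.v *)
From HB Require Import structures.
From mathcomp Require Import all_boot all_order all_algebra.
From mathcomp Require Import spectral.
From mathcomp Require Import all_classical all_reals all_analysis.
From mathcomp.real_closed Require Import complex.
(* The notations of mpoly clash with those of mathcomp-analysis. *)
From mathcomp Require Import -(notations) mpoly.

Set Implicit Arguments.
Unset Strict Implicit.
Unset Printing Implicit Defensive.

Import Order.TTheory GRing.Theory Num.Theory.
Import numFieldNormedType.Exports.

Local Open Scope classical_set_scope.
Local Open Scope ring_scope.
Local Open Scope sesquilinear_scope.

(* R[i] with its numClosedFieldType structure made explicit: the topology and
   the normed-module structure of complex vectors and matrices are inferred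
   from it. *)
Definition Cplx (R : realType) : numClosedFieldType := (R[i])%C.

Section ProjectiveGeometry.
Variables (R : realType) (n : nat).

Local Notation C := (Cplx R).
Local Notation vec := 'rV[C]_n.+1.
Local Notation mat := 'M[C]_n.+1.
Local Notation space := {vspace 'rV[C]_n.+1}.

(* Conventions.
   - A point of P^n is given by any nonzero vector representing it, and a subset
     of P^n by the set of all its nonzero representatives (a cone minus 0).
   - A projective linear subspace L is given by the linear subspace of C^{n+1}
     over it, so G(s, P^n) is the set of linear subspaces of dimension s + 1.
   - Vectors are rows; a matrix A is the linear map v |-> v *m A. *)

(** * Projective varieties *)

Definition homogeneous k (f : mpoly k C) : Prop :=
  exists d, f \is ishomog1 d mdeg.

Definition zeros (F : set (mpoly n.+1 C)) : set vec :=
  [set z | z != 0 /\ forall f, F f -> meval (z ord0) f = 0].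

Definition zariski_closed (X : set vec) : Prop :=
  exists2 F, (forall f, F f -> homogeneous f) & X = zeros F.

Definition irreducible_variety (X : set vec) : Prop :=
  [/\ zariski_closed X, X !=set0 &
      forall A B, zariski_closed A -> zariski_closed B ->
        X `<=` A `|` B -> X `<=` A \/ X `<=` B].

(* Krull dimension: X contains a chain X_0 < ... < X_k of irreducible closed
   sets. *)
Definition dim_at_least (X : set vec) (k : nat) : Prop :=
  exists c : nat -> set vec,
    [/\ forall i, (i <= k)%N -> irreducible_variety (c i),
        forall i, (i < k)%N -> c i `<` c i.+1 &
        c k `<=` X].

Definition has_dim (X : set vec) (m : nat) : Prop :=
  dim_at_least X m /\ ~ dim_at_least X m.+1.

(** * Tangent spaces *)

Definition tangentP (z : vec) : set vec := [set w | dotmx w z = 0].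

Definition tangentL (L : space) (z : vec) : set vec :=
  [set w | w \in L /\ tangentP z w].

Definition tangentZ (Z : set vec) (z : vec) : set vec :=
  [set w | tangentP z w /\
     forall f : mpoly n.+1 C, homogeneous f ->
       (forall v, Z v -> meval (v ord0) f = 0) ->
       \sum_(i < n.+1) meval (z ord0) (mderiv i f) * w ord0 i = 0].

Definition smooth_point (Z : set vec) (z : vec) : Prop :=
  Z z /\ exists2 T : space, tangentZ Z z = [set` T] & has_dim Z (\dim T).

Definition Sing (Z : set vec) : set vec := [set z | Z z /\ ~ smooth_point Z z].

Definition transversal (Z : set vec) (L : space) (z : vec) : Prop :=
  [set u + v | u in tangentZ Z z & v in tangentL L z] = tangentP z.

(** * The Grassmannian and its hermitian metric *)

Definition Grass (s : nat) : set space := [set L | \dim L = s.+1].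

Definition vnorm (u : vec) : R := Num.sqrt (complex.Re (dotmx u u)).

Definition fs_norm (z w : vec) : R := vnorm w / vnorm z.

(* tr (A A^* ) is the same in all orthonormal bases. *)
Definition hs_norm (A : mat) : R := Num.sqrt (complex.Re (\tr (A *m A^t*))).

(* Hom(L, L^perp), a linear map being extended by 0 on L^perp. *)
Definition tangentG (L : space) : set mat :=
  [set A | (forall v, (forall u, u \in L -> dotmx v u = 0) -> v *m A = 0) /\
           (forall v u, u \in L -> dotmx (v *m A) u = 0)].

(* The image of L under 1 + A; for A in Hom(L, L^perp) it is the graph of A.
   A |-> translate L A is a holomorphic submersion from a neighbourhood of 0
   onto a neighbourhood of L in the Grassmannian; its differential at 0 maps A
   in Hom(L, L^perp) to the tangent vector A. It is used both for the topology
   and for the complex structure of the Grassmannian. *)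
Definition translate (L : space) (A : mat) : space :=
  (linfun (mulmxr (1%:M + A : mat)) @: L)%VS.

Definition open_in_Grass (k : nat) (U : set space) : Prop :=
  forall L, U L -> \dim L = k /\ \forall A \near (0 : mat), U (translate L A).

(* V is open in Z, both being regarded as subsets of P^n. *)
Definition open_in (Z V : set vec) : Prop :=
  (forall (a : C) v, a != 0 -> V v -> V (a *: v)) /\
  exists2 W : set vec, open W & V = Z `&` W.

(** * Condition numbers *)

(* gamma : U -> V is the local solution map, given by a holomorphic choice of
   representatives with gamma(L) = z. Complex differentiability at every point
   of the open set U means that gamma is holomorphic. *)
Definition solution_map (Z : set vec) (L : space) (z : vec)
    (gamma : space -> vec) : Prop :=
  exists (U : set space) (V : set vec),
    [/\ open_in_Grass (\dim L) U /\ U L,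
        open_in Z V /\ V z,
        forall L', U L' ->
          [set v | V v /\ v \in L'] =
          [set a *: gamma L' | a in [set a : C | a != 0]],
        forall L', U L' ->
          differentiable (fun A : mat => gamma (translate L' A)) (0 : mat) &
        gamma L = z].

(* The differential at z of the projection C^{n+1} \ {0} -> P^n, with T_z P^n
   modelled as the orthogonal complement of z. *)
Definition to_tangentP (z w : vec) : vec :=
  w - (dotmx w z / dotmx z z) *: z.

Definition D_solution (L : space) (z : vec) (gamma : space -> vec) (A : mat) :
    vec :=
  to_tangentP z ('d (fun B : mat => gamma (translate L B)) (0 : mat) A).

Definition op_norm (L : space) (z : vec) (D : mat -> vec) : \bar R :=
  ereal_sup [set (fs_norm z (D A))%:E | A in
    [set A | tangentG L A /\ hs_norm A <= 1]].

(* A solution map exists at a transversal smooth point, and it is unique near L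
   up to the choice of the representatives, which does not affect D_solution:
   the supremum is that of a set with exactly one element. *)
Definition kappa_at (Z : set vec) (L : space) (z : vec) : \bar R :=
  if `[< smooth_point Z z /\ transversal Z L z >] then
    ereal_sup [set op_norm L z (D_solution L z gamma) | gamma in
      solution_map Z L z]
  else +oo%E.

Definition meetZ (Z : set vec) (L : space) : set vec :=
  [set z | Z z /\ z \in L].

Definition Irrel (s : nat) (Z : set vec) : set space :=
  [set L | Grass s L /\
     ((exists2 z, Sing Z z & z \in L) \/ dim_at_least (meetZ Z L) 1)].

(* Outside Irrel the intersection is finite and nonempty when
   dim Z + s = n, so that the supremum is a maximum. *)
Definition kappa (s : nat) (Z : set vec) (L : space) : \bar R :=
  if `[< Irrel s Z L >] then +oo%E
  else ereal_sup [set kappa_at Z L z | z in meetZ Z L].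

(** * The Hurwitz variety *)

Definition Schubert (s : nat) (Z : set vec) (z : vec) : set space :=
  [set L | [/\ Grass s L, z \in L &
     exists w, [/\ w != 0, tangentZ Z z w & tangentL L z w]]].

(* The rows are a basis of L when k = \dim L. *)
Definition basis_mx k (L : space) : 'M[C]_(k, n.+1) :=
  \matrix_(i < k) (vbasis L)`_i.

Definition increasing_maps k : {set {ffun 'I_k -> 'I_n.+1}} :=
  [set f : {ffun 'I_k -> 'I_n.+1} |
     [forall i : 'I_k, forall j : 'I_k, (i < j)%N ==> (f i < f j)%N]]%SET.

Definition plucker k (L : space) (j : 'I_#|increasing_maps k|) : C :=
  \det (colsub (enum_val j) (basis_mx k L)).

Definition zariski_closed_in_Grass (s : nat) (X : set space) : Prop :=
  exists2 F : set (mpoly #|increasing_maps s.+1| C),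
    (forall f, F f -> homogeneous f) &
    X = [set L | Grass s L /\ forall f, F f -> meval (@plucker s.+1 L) f = 0].

Definition zariski_closure_in_Grass (s : nat) (X : set space) : set space :=
  \bigcap_(Y in [set Y | zariski_closed_in_Grass s Y /\ X `<=` Y]) Y.

Definition Hurwitz (s : nat) (Z : set vec) : set space :=
  zariski_closure_in_Grass s
    (\bigcup_(z in [set z | smooth_point Z z]) Schubert s Z z).

(** * Geodesic distance *)

Definition oproj (L : space) : mat := proj_ortho (basis_mx (\dim L) L).

Definition re_mx (M : R -> mat) (t : R) : 'M[R]_n.+1 :=
  map_mx (@complex.Re R) (M t).

Definition im_mx (M : R -> mat) (t : R) : 'M[R]_n.+1 :=
  map_mx (@complex.Im R) (M t).

Definition C1_mx (M : R -> mat) : Prop :=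
  [/\ forall t, derivable (re_mx M) t 1, forall t, derivable (im_mx M) t 1,
      continuous (derive1 (re_mx M)) & continuous (derive1 (im_mx M))].

Definition deriv_mx (M : R -> mat) (t : R) : mat :=
  \matrix_(i, j) (Complex (derive1 (re_mx M) t i j)
                          (derive1 (im_mx M) t i j) : C).

(* The velocity of a curve c in Hom(c t, (c t)^perp): for v in c t, the curve
   v *m oproj (c u) lies in c u and passes through v at u = t, and the velocity
   maps v to the component orthogonal to c t of its derivative. *)
Definition velocity (c : R -> space) (t : R) : mat :=
  let P := oproj (c t) in
  P *m deriv_mx (fun u => oproj (c u)) t *m (1%:M - P).

Definition curve_length (c : R -> space) : R :=
  \int[lebesgue_measure]_(t in `[0, 1]) hs_norm (velocity c t).

(* The embedding oproj of the Grassmannian is smooth, so these are C^1 curves.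
   By reparametrization, so that they stop at the break points, they give the
   same distance as piecewise C^1 curves. *)
Definition C1_path (L L' : space) : set (R -> space) :=
  [set c | [/\ forall t, \dim (c t) = \dim L, C1_mx (fun t => oproj (c t)),
               c 0 = L & c 1 = L']].

Definition d_g (L L' : space) : \bar R :=
  ereal_inf [set (curve_length c)%:E | c in C1_path L L'].

Definition d_g_set (L : space) (X : set space) : \bar R :=
  ereal_inf [set d_g L L' | L' in X].

Definition tube (s : nat) (X : set space) (eps : R) : set space :=
  [set L | Grass s L /\ (d_g_set L X <= (asin eps)%:E)%E].

End ProjectiveGeometry.

(* Main.v *)
Require Import Defs.
From mathcomp Require Import all_boot all_order all_algebra.
From mathcomp Require Import spectral.
From mathcomp Require Import all_classical all_reals all_analysis.
From mathcomp.real_closed Require Import complex.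
From mathcomp Require Import ring.
From mathcomp Require Import -(notations) mpoly.

(** Let [L] have condition number at least [1 / eps] and lie outside the
irrelevant set, so that every point [z] of the intersection of [Z] and [L] is
smooth on [Z].  If [L] is not transversal to [Z] at [z], the tangent spaces,
whose dimensions add up to that of the ambient one, share a nonzero vector by
counting dimensions: [L] itself is in the Schubert variety of [z].

At a transversal point, let [w] be the derivative of the solution map in a
direction [A] of norm at most 1.  Two facts about [w] suffice:
- [w] is tangent to [Z], because the solution map takes its values in [Z]
  ([D_solution_tangent]);
- the component of [w] orthogonal to [L] is [z *m A], because the solution map
  stays on the moving subspace ([D_solution_normal]).
So the sine [x] of the angle between [w] and [L] satisfies
[x * |w| = |z *m A| <= |z|], that is, [|w| / |z| <= 1 / x].  Now turn [L] by
that angle, in the plane spanned by [w] and its projection to [L], keeping fixed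
the part of [L] orthogonal to the plane.  The result contains both [z] and [w],
hence is in the Schubert variety of [z], and the rotation is a path of length
[asin x] ([d_g_turn], [rotate_into]).  Thus every value [|w| / |z|] is at most
[1 / x] for some [x] such that [asin x] is at least the distance from [L] to the
Hurwitz variety.  If this distance exceeded [asin eps], the values would be
bounded away from [1 / eps] ([asin_gap]), and so would their supremum, which is
the condition number. *)

Set Implicit Arguments.
Unset Strict Implicit.
Unset Printing Implicit Defensive.

Import Order.TTheory GRing.Theory Num.Theory.
Import numFieldNormedType.Exports.

Local Open Scope classical_set_scope.
Local Open Scope ring_scope.
Local Open Scope sesquilinear_scope.

(** * Inequalities between real numbers *)

Section RealInequalities.
Variable R : realType.

Lemma leg_le_hypotenuse (a b k : R) : 0 <= b -> 0 <= k ->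
  k ^+ 2 = a ^+ 2 + b ^+ 2 -> b <= k.
Proof. by move=> b0 k0 k2; rewrite -ler_sqr ?nnegrE// k2 lerDr sqr_ge0. Qed.

Lemma asin_ge0 (x : R) : 0 <= x <= 1 -> 0 <= asin x.
Proof.
move=> /andP[x0 x1].
have xI : -1 <= x <= 1 by rewrite x1 (le_trans _ x0)// lerN10.
rewrite leNgt -ltr_sin ?in_itv/= ?asinK ?in_itv//= ?sin0 -?leNgt//.
  by rewrite asin_geNpi2// asin_lepi2.
by rewrite oppr_le0 divr_ge0 ?pi_ge0.
Qed.

Lemma ler_ratio (p w z c : R) : 0 < w -> 0 < z -> 0 <= c ->
  p <= z -> 1 <= c * (p / w) -> w / z <= c.
Proof.
move=> w0 z0 c0 pz; rewrite mulrA ler_pdivlMr// mul1r => wcp.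
by rewrite ler_pdivrMr// (le_trans wcp)// ler_wpM2l.
Qed.

(** The strict inequality leaves room for a bound [c] on [1 / x] that is uniform
in [x] and still below [1 / eps]; this is what makes an unattained supremum
harmless.  If [d] exceeds [pi / 2], no [x] qualifies, and [c] can be 0. *)
Lemma asin_gap (eps : R) (d : \bar R) : 0 < eps -> eps <= 1 ->
    ((asin eps)%:E < d)%E ->
  exists c, [/\ 0 <= c, c < eps^-1 &
    forall x, 0 <= x <= 1 -> (d <= (asin x)%:E)%E -> 1 <= c * x].
Proof.
move=> eps0 eps1 epsd.
have epsI : -1 <= eps <= 1 by rewrite eps1 (le_trans _ (ltW eps0))// lerN10.
have [dpi|dpi] := leP d (pi / 2)%:E; last first.
  exists 0; rewrite invr_gt0; split=> // x /andP[x0 x1] dx.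
  have xI : -1 <= x <= 1 by rewrite x1 (le_trans _ x0)// lerN10.
  have := lt_le_trans dpi dx; rewrite lte_fin ltNge asin_lepi2//.
case: d epsd dpi => [r| |] //; rewrite lte_fin lee_fin => er rpi.
have rI : r \in `[- (pi / 2), pi / 2].
  by rewrite in_itv/= rpi andbT (le_trans (asin_geNpi2 epsI))// ltW.
have es : eps < sin r.
  rewrite -[ltLHS]asinK ?in_itv// ltr_sin// in_itv/=.
  by rewrite asin_geNpi2// asin_lepi2.
have s0 := lt_trans eps0 es.
exists (sin r)^-1; split; [by rewrite invr_ge0 ltW|by rewrite ltf_pV2|].
move=> x /andP[x0 x1]; rewrite lee_fin => rx.
have xI : -1 <= x <= 1 by rewrite x1 (le_trans _ x0)// lerN10.
rewrite mulrC ler_pdivlMr// mul1r -[leRHS]asinK ?in_itv// leNgt ltr_sin//.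
  by rewrite -leNgt.
by rewrite in_itv/= asin_geNpi2// asin_lepi2.
Qed.

End RealInequalities.

(** * Rank-one matrices *)

Section RankOneExpansions.
Variables (K : comNzRingType) (p : nat).
Variables (e f : 'rV[K]_p) (e' f' : 'cV[K]_p) (c s : K).

(** With [c] and [s] the cosine and the sine of an angle, [c *: e + s *: f] is
[e] turned towards [f].  Writing [c * c] as [1 - s * s] puts the orthogonal
projection to its line in the form [N0 + a N1 + b N2], with fixed matrices. *)
Lemma arc_square : c * c = 1 - s * s ->
  (c *: e' + s *: f') *m (c *: e + s *: f) - e' *m e =
  (c * s) *: (e' *m f + f' *m e) + (s * s) *: (f' *m f - e' *m e).
Proof.
move=> c2; rewrite mulmxDl !mulmxDr -!scalemxAl -!scalemxAr !scalerA c2.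
move: (e' *m e) (e' *m f) (f' *m e) (f' *m f) => A B D E.
by apply/matrixP => i j; rewrite !mxE; ring.
Qed.

(** The right-hand side is what differentiating the coefficients of [arc_square]
gives; the left-hand side is the product rule, as [- s *: e + c *: f] is the
derivative of [c *: e + s *: f]. *)
Lemma arc_leibniz :
  ((- s) *: e' + c *: f') *m (c *: e + s *: f) +
  (c *: e' + s *: f') *m ((- s) *: e + c *: f) =
  (c * c - s * s) *: (e' *m f + f' *m e) +
  (2 * s * c) *: (f' *m f - e' *m e).
Proof.
rewrite !mulmxDl !mulmxDr -!scalemxAl -!scalemxAr !scalerA.
move: (e' *m e) (e' *m f) (f' *m e) (f' *m f) => A B D E.
by apply/matrixP => i j; rewrite !mxE; ring.
Qed.

(** Only the line of [e] moves, in the direction [f]; the range of [Q] is fixed.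
This is the velocity of the projection [Q + e' *m e]. *)
Lemma rank_one_velocity (Q : 'M[K]_p) :
    Q *m e' = 0 -> Q *m f' = 0 -> f *m Q = 0 ->
    e *m e' = 1%:M -> e *m f' = 0 -> f *m e' = 0 ->
  (Q + e' *m e) *m (f' *m e + e' *m f) *m (1%:M - (Q + e' *m e)) = e' *m f.
Proof.
move=> Qe Qf fQ ee ef fe.
rewrite (_ : (Q + e' *m e) *m _ = e' *m f); last first.
  rewrite mulmxDl !mulmxDr !mulmxA Qe Qf !mul0mx !add0r.
  by rewrite -!(mulmxA e') ee ef mul0mx mulmx0 add0r mul1mx.
rewrite mulmxBr mulmx1 mulmxDr -mulmxA fQ mulmx0 add0r.
by rewrite -!mulmxA [f *m _]mulmxA fe mul0mx mulmx0 subr0.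
Qed.

End RankOneExpansions.

(** * Derivatives along polynomials and matrices *)

Section Derivatives.
Variable K : numFieldType.

Lemma is_derive_zero (f : K -> K) (x d : K) :
  is_derive x 1 f d -> (\forall h \near x, f h = 0) -> d = 0.
Proof.
move=> [_ <-] f0; rewrite (near_eq_derive (g := cst 0))//.
exact: derive_cst.
Qed.

Lemma is_derive_ray p q (F : 'M[K]_p.+1 -> 'rV[K]_q.+1) (A : 'M[K]_p.+1) :
  differentiable F 0 ->
  is_derive (0 : K) 1 (fun h : K => F (h *: A)) ('d F 0 A).
Proof.
move=> dF; have s0 : (0 : K) *: A = 0 by rewrite scale0r.
have ds : differentiable (fun h : K => h *: A) (0 : K).
  exact: differentiableZl.
have dF' : differentiable F ((0 : K) *: A) by rewrite s0.
apply: DeriveDef; first exact/diff_derivable/differentiable_comp.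
rewrite deriveE; last exact: differentiable_comp.
rewrite diff_comp//= s0.
rewrite diffZl//. have -> : 'd id (0 : K) 1 = 1 by rewrite -deriveE ?derive_id.
by rewrite scale1r.
Qed.

Lemma is_derive_coord q (G : K -> 'rV[K]_q.+1) (g : 'rV[K]_q.+1) (x : K) i :
  is_derive x 1 G g -> is_derive x 1 (fun h => G h ord0 i : K) (g ord0 i).
Proof.
move=> [dG <-].
pose quotient (h : K) : K := h^-1 *:
  (((fun h : K => G h ord0 i : K) \o shift x) (h *: (1 : K)) - G x ord0 i).
have cv : quotient h @[h --> 0^'] --> ('D_1 G x) ord0 i.
  rewrite (_ : quotient = (fun N : 'rV[K]_q.+1 => N ord0 i : K) \o
    (fun h : K => h^-1 *: ((G \o shift x) (h *: (1 : K)) - G x))); last first.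
    by apply/funext => h; rewrite /quotient /= !mxE.
  have dd : (fun h : K => h^-1 *: ((G \o shift x) (h *: (1 : K)) - G x))
      @ 0^' --> 'D_1 G x by exact: dG.
  have cc : (fun N : 'rV[K]_q.+1 => N ord0 i : K) @ (nbhs ('D_1 G x)) -->
      ('D_1 G x) ord0 i by exact: coord_continuous.
  exact: cvg_comp dd cc.
by split; [exact: cvgP cv|exact: cvg_lim cv].
Qed.

Lemma is_derive_mulmx_coord q (G : K -> 'rV[K]_q.+1) (g : 'rV[K]_q.+1)
    (B : 'M[K]_q.+1) (x : K) j : is_derive x 1 G g ->
  is_derive x 1 (fun h => (G h *m B) ord0 j) ((g *m B) ord0 j).
Proof.
move=> dG; rewrite mxE.
have -> : (fun h => (G h *m B) ord0 j) =
    \sum_(i < q.+1) (B i j \*: fun h => G h ord0 i).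
  rewrite fct_sumE; apply/funext => h; rewrite mxE.
  by apply: eq_bigr => i _; rewrite mulrC.
apply: is_derive_eq.
  by apply: is_derive_sum => i; apply: is_deriveZ; exact: is_derive_coord.
by apply: eq_bigr => i _; rewrite mulrC.
Qed.

Section Polynomials.
Variables (k : nat) (phi : 'I_k -> K -> K) (dphi : 'I_k -> K) (x : K).
Hypothesis dphiP : forall i, is_derive x 1 (phi i) (dphi i).

(* The chain rule; it is stable under sums and products, hence holds for all
   polynomials once it holds for constants and variables. *)
Let chain (f : mpoly k K) : Prop :=
  is_derive x 1 (fun h => meval (phi^~ h) f)
    (\sum_(i < k) meval (phi^~ x) (mderiv i f) * dphi i).

Let chainC c : chain (mpolyC k c).
Proof.
rewrite /chain (_ : (fun h => _) = cst c); last first.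
  by apply/funext => h; rewrite mevalC.
rewrite big1 => [|i _]; first exact: is_derive_cst.
by rewrite mderivC meval0 mul0r.
Qed.

Let chainU i : chain (mpolyX K (mnm1 i)).
Proof.
rewrite /chain (_ : (fun h => _) = phi i); last first.
  by apply/funext => h; rewrite mevalXU.
rewrite (bigD1 i)//= big1 => [|j ji].
  rewrite addr0 mderivX mnm1E eqxx scale1r mevalX big1 ?mul1r// => l _.
  by rewrite mnmBE subnn expr0.
by rewrite mderivX mnm1E eq_sym (negPf ji) scale0r meval0 mul0r.
Qed.

Let chainD f g : chain f -> chain g -> chain (f + g).
Proof.
move=> cf cg; rewrite /chain (_ : (fun h => _) =
  (fun h => meval (phi^~ h) f) + (fun h => meval (phi^~ h) g)); last first.
  by apply/funext => h; rewrite mevalD.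
apply: is_derive_eq; first exact: (is_deriveD cf cg).
by rewrite -big_split/=; apply: eq_bigr => i _; rewrite mderivD mevalD mulrDl.
Qed.

Let chainM f g : chain f -> chain g -> chain (f * g).
Proof.
move=> cf cg; rewrite /chain (_ : (fun h => _) =
  (fun h => meval (phi^~ h) f) * (fun h => meval (phi^~ h) g)); last first.
  by apply/funext => h; rewrite mevalM.
apply: is_derive_eq; first exact: (is_deriveM cf cg).
rewrite /GRing.scale/= !mulr_sumr -big_split/=; apply: eq_bigr => i _.
by rewrite mderivM mevalD !mevalM; ring.
Qed.

Lemma is_derive_meval (f : mpoly k K) :
  is_derive x 1 (fun h => meval (phi^~ h) f)
    (\sum_(i < k) meval (phi^~ x) (mderiv i f) * dphi i).
Proof.
rewrite -/(chain f); elim/mpolyind: f => [|c m p _ _ IH].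
  by rewrite -[0]/(mpolyC k 0); exact: chainC.
apply: chainD => //; rewrite -mul_mpolyC; apply: chainM; first exact: chainC.
rewrite mpolyXE_id; elim/big_ind: _ => [|f g|i _].
- exact: chainC.
- exact: chainM.
elim: (m i) => [|e IHe]; first by rewrite expr0; exact: chainC.
by rewrite exprS; apply: chainM.
Qed.

(** A curve in the zero set of [f] is tangent to it. *)
Lemma gradient_along_zeros (f : mpoly k K) :
  (\forall h \near x, meval (phi^~ h) f = 0) ->
  \sum_(i < k) meval (phi^~ x) (mderiv i f) * dphi i = 0.
Proof. exact/is_derive_zero/is_derive_meval. Qed.

End Polynomials.

Lemma near_1D_neq0 : \forall h \near (0 : K), 1 + h != 0.
Proof.
have := @nbhs0_lt K K 1 ltr01; apply: filterS => h; apply: contraTneq.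
by move/eqP; rewrite addrC addr_eq0 => /eqP ->; rewrite normrN1 ltxx.
Qed.

Lemma is_derive_affine (a b x : K) : is_derive x 1 (fun h : K => a + h * b) b.
Proof.
have d : is_derive x 1 (cst a + b \*: id) (0 + b *: 1).
  by apply: is_deriveD.
rewrite add0r [b *: 1]mulr1 in d.
rewrite (_ : (fun h => _) = cst a + b \*: id)//.
by apply/funext => h; rewrite mulrC.
Qed.

End Derivatives.

Lemma is_derive_scale (R : realType) (V : normedModType R) (a : R -> R)
    (a' t : R) (v : V) :
  is_derive t 1 a a' -> is_derive t 1 (fun t => a t *: v) (a' *: v).
Proof.
move=> da; have dfa : differentiable a t by apply/derivable1_diffP.
apply: DeriveDef; first by apply/diff_derivable/differentiableZl.
rewrite deriveE ?diffZl//; last exact: differentiableZl.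
by rewrite -deriveE// derive_val.
Qed.

Section ProjectiveGeometry.
Variables (R : realType) (n : nat).

Local Notation C := (Cplx R).
Local Notation vec := 'rV[C]_n.+1.
Local Notation mat := 'M[C]_n.+1.
Local Notation space := {vspace 'rV[C]_n.+1}.
Local Notation rC x := (real_complex R x : C).

Let rCN x : rC (- x) = - rC x. Proof. exact: rmorphN. Qed.
Let rCB x y : rC (x - y) = rC x - rC y. Proof. exact: rmorphB. Qed.
Let rCD x y : rC (x + y) = rC x + rC y. Proof. exact: rmorphD. Qed.
Let rCM x y : rC (x * y) = rC x * rC y. Proof. exact: rmorphM. Qed.
Let conj_rC x : (rC x)^* = rC x. Proof. exact: conjc_real. Qed.

(** * Orthogonal projections *)

Lemma adjointM p q r (A : 'M[C]_(p, q)) (B : 'M[C]_(q, r)) :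
  (A *m B)^t* = B^t* *m A^t*.
Proof. by rewrite trmx_mul map_mxM. Qed.

Lemma adjointD p q (A B : 'M[C]_(p, q)) : (A + B)^t* = A^t* + B^t*.
Proof. by rewrite linearD /= map_mxD. Qed.

Lemma adjointB p q (A B : 'M[C]_(p, q)) : (A - B)^t* = A^t* - B^t*.
Proof. by rewrite linearB /= map_mxB. Qed.

Lemma adjointZ p q (a : C) (A : 'M[C]_(p, q)) : (a *: A)^t* = a^* *: A^t*.
Proof. by rewrite linearZ /= map_mxZ. Qed.

Lemma mul_adj (u v : vec) : u *m v^t* = (dotmx u v)%:M.
Proof. by rewrite dotmxE -mx11_scalar. Qed.

Lemma dotmxC (u v : vec) : dotmx u v = (dotmx v u)^*.
Proof. by rewrite hermC /= expr0 mul1r. Qed.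

Lemma dotmx_eq0 (v : vec) : (dotmx v v == 0) = (v == 0).
Proof. exact: (dnorm_eq0 (@dotmx _ n.+1)). Qed.

Lemma dotmx_mull (A : mat) (u v : vec) :
  dotmx (u *m A) v = dotmx u (v *m A^t*).
Proof. by rewrite !dotmxE adjointM trmxCK mulmxA. Qed.

Lemma mem_basis_mx (L : space) (v : vec) :
  (v \in L) = (v <= basis_mx (\dim L) L)%MS.
Proof.
apply/idP/idP => [/coord_vbasis ->|/submxP[a ->]].
  apply: summx_sub => i _; apply: scalemx_sub.
  have -> : (vbasis L)`_i = row i (basis_mx (\dim L) L) by rewrite rowK.
  exact: row_sub.
rewrite mulmx_sum_row; apply: memv_suml => i _; apply: memvZ.
by rewrite rowK vbasis_mem// mem_nth// size_tuple.
Qed.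

Lemma oproj_id (L : space) (v : vec) : v \in L -> v *m oproj L = v.
Proof. by rewrite mem_basis_mx; exact: proj_ortho_id. Qed.

Lemma oproj_mem (L : space) (v : vec) : v *m oproj L \in L.
Proof. by rewrite mem_basis_mx; exact: proj_ortho_sub. Qed.

Lemma oproj_idem (L : space) : oproj L *m oproj L = oproj L.
Proof. exact: proj_ortho_proj. Qed.

Lemma oproj_herm (L : space) : (oproj L)^t* = oproj L.
Proof.
set P := oproj L.
have PP : P^t* = P *m P^t*.
  apply/eqP; rewrite -subr_eq0 -[X in X - _]mul1mx -mulmxBl -orthomx1E.
  have := proj_ortho_compl_sub (basis_mx (\dim L) L) (1%:M : mat).
  rewrite mul1mx => /submx_trans; apply.
  by rewrite submx_ortho -[P]mul1mx proj_ortho_sub.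
by move: P PP => P PP; rewrite -[RHS]trmxCK [in RHS]PP adjointM trmxCK -PP.
Qed.

Opaque oproj.

Lemma oproj_unique (L : space) (Q : mat) :
    (forall v, v *m Q \in L) -> (forall v, v \in L -> v *m Q = v) ->
  Q^t* = Q -> oproj L = Q.
Proof.
move=> QL Qid Qh; set P := oproj L.
have PQ : P *m Q = P.
  by apply/row_matrixP => i; rewrite row_mul Qid// rowE oproj_mem.
have QP : Q *m P = Q.
  by apply/row_matrixP => i; rewrite row_mul oproj_id// rowE.
by rewrite -[RHS]Qh -QP adjointM Qh oproj_herm PQ.
Qed.

Lemma oproj0 (L : space) (v : vec) :
  (forall u, u \in L -> dotmx v u = 0) -> v *m oproj L = 0.
Proof.
move=> vL; apply/eqP; rewrite -dotmx_eq0; apply/eqP.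
by rewrite dotmx_mull oproj_herm vL // oproj_mem.
Qed.

Lemma oproj_orth (L : space) (v u : vec) :
  u \in L -> dotmx (v - v *m oproj L) u = 0.
Proof.
by move=> uL; rewrite linearBl/= dotmx_mull oproj_herm oproj_id// subrr.
Qed.

(** A path of subspaces is constructed as the images of [L] under partial
isometries [N] with initial space [L]: this form gives the dimension and the
projection of the image without choosing bases. *)
Section PartialIsometry.
Variables (L : space) (N : mat).
Hypotheses (NN : N *m N^t* = oproj L) (PN : oproj L *m N = N).

Let image := (linfun (mulmxr N) @: L)%VS.

Lemma dim_isometry_image : \dim image = \dim L.
Proof.
rewrite limg_dim_eq//; apply/eqP; rewrite -subv0; apply/subvP => v.
rewrite memv_cap memv_ker lfunE /= => /andP[vL /eqP vN].
by rewrite memv0 -(oproj_id vL) -NN mulmxA vN mul0mx.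
Qed.

Lemma oproj_isometry_image : oproj image = N^t* *m N.
Proof.
apply: oproj_unique.
- move=> v; rewrite mulmxA; apply/memv_imgP; exists (v *m N^t*).
    by rewrite -PN adjointM oproj_herm mulmxA oproj_mem.
  by rewrite lfunE.
- move=> _ /memv_imgP[v vL ->].
  by rewrite lfunE /= mulmxA -(mulmxA v) NN oproj_id.
- by rewrite adjointM trmxCK.
Qed.

End PartialIsometry.

(** * Norms *)

Lemma dotmx_vnorm (u : vec) : dotmx u u = rC (vnorm u ^+ 2).
Proof.
have u0 : 0 <= dotmx u u by exact: (dnorm_ge0 (@dotmx C n.+1)).
have := u0; rewrite lecE /= => /andP[/eqP im0 re0].
by rewrite sqr_sqrtr//; case: (dotmx u u) im0 => a b /= ->.
Qed.

Lemma vnorm_ge0 (u : vec) : 0 <= vnorm u. Proof. exact: sqrtr_ge0. Qed.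

Lemma vnorm0 : vnorm (0 : vec) = 0 :> R.
Proof. by rewrite /vnorm linear0r sqrtr0. Qed.

Lemma vnorm_eq0 (u : vec) : (vnorm u == 0) = (u == 0).
Proof.
apply/eqP/eqP => [u0|->]; last exact: vnorm0.
by apply/eqP; rewrite -dotmx_eq0 dotmx_vnorm u0 expr0n.
Qed.

Lemma vnorm_gt0 (u : vec) : u != 0 -> 0 < vnorm u.
Proof. by move=> u0; rewrite lt_neqAle eq_sym vnorm_eq0 u0 vnorm_ge0. Qed.

Lemma vnorm_pythagoras (u v : vec) : dotmx u v = 0 ->
  vnorm (u + v) ^+ 2 = vnorm u ^+ 2 + vnorm v ^+ 2.
Proof.
move=> uv; have : dotmx (u + v) (u + v) = dotmx u u + dotmx v v.
  exact: (@hnormDd _ _ _ _ (@dotmx C n.+1)).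
by rewrite !dotmx_vnorm -rCD => /complexI.
Qed.

Definition normalize (u : vec) : vec := rC (vnorm u)^-1 *: u.

Lemma normalizeK (u : vec) : u != 0 -> rC (vnorm u) *: normalize u = u.
Proof. by move=> u0; rewrite scalerA -rCM mulfV ?vnorm_eq0// scale1r. Qed.

Lemma dotmx_normalize (u : vec) :
  u != 0 -> dotmx (normalize u) (normalize u) = 1.
Proof.
move=> u0; rewrite linearZl_LR/= linearZr_LR/= dotmx_vnorm.
rewrite conj_rC.
by rewrite -!rCM (_ : _ * _ = 1 :> R)//; field; rewrite vnorm_eq0.
Qed.

Lemma dotmx_normalize0 (u v : vec) : dotmx u v = 0 -> dotmx (normalize u) v = 0.
Proof. by move=> uv; rewrite linearZl_LR/= uv mulr0. Qed.

Lemma mxtrace_adj (A : mat) : \tr (A *m A^t* ) =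
  \sum_j dotmx ((col j A)^t* ) ((col j A)^t* ).
Proof.
rewrite mxtrace_mulC; apply: eq_bigr => j _.
by rewrite dotmxE trmxCK !mxE; apply: eq_bigr => i _; rewrite !mxE.
Qed.

Lemma hs_normE (A : mat) : rC (hs_norm A ^+ 2) = \tr (A *m A^t* ).
Proof.
have t0 : 0 <= \tr (A *m A^t* ).
  by rewrite mxtrace_adj sumr_ge0// => j _; exact: (dnorm_ge0 (@dotmx C n.+1)).
have := t0; rewrite lecE /= => /andP[/eqP im0 re0].
by rewrite sqr_sqrtr//; case: (\tr _) im0 => a b /= ->.
Qed.

(** The Cauchy-Schwarz inequality for each column of [A]. *)
Lemma vnorm_mulmx (z : vec) (A : mat) :
  vnorm (z *m A) <= vnorm z * hs_norm A.
Proof.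
have hs0 : 0 <= hs_norm A by exact: sqrtr_ge0.
rewrite -ler_sqr ?nnegrE ?mulr_ge0 ?vnorm_ge0// exprMn.
suff : rC (vnorm (z *m A) ^+ 2) <= rC (vnorm z ^+ 2 * hs_norm A ^+ 2).
  by rewrite lecR.
rewrite -dotmx_vnorm.
rewrite (_ : rC (_ * _) = dotmx z z * \tr (A *m A^t* )); last first.
  by rewrite dotmx_vnorm -hs_normE; exact: rCM.
rewrite mxtrace_adj mulr_sumr [leLHS]dotmxE mxE; apply: ler_sum => j _.
have -> : (z *m A) ord0 j * (z *m A)^t* j ord0 =
    `|dotmx z ((col j A)^t* )| ^+ 2.
  rewrite normCK dotmxE trmxCK !mxE; congr (_ * _^*);
    by apply: eq_bigr => i _; rewrite mxE.
exact: (CauchySchwarz (@dotmx C n.+1)).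
Qed.

Lemma vnorm_oproj_compl (L : space) (w : vec) :
  vnorm w ^+ 2 = vnorm (w *m oproj L) ^+ 2 + vnorm (w - w *m oproj L) ^+ 2.
Proof.
have lp : dotmx (w *m oproj L) (w - w *m oproj L) = 0.
  by rewrite dotmxC oproj_orth ?raddf0// oproj_mem.
by rewrite -(vnorm_pythagoras lp) addrC subrK.
Qed.

Lemma vnorm_oproj_compl_le (L : space) (w : vec) :
  vnorm (w - w *m oproj L) <= vnorm w.
Proof.
exact: (leg_le_hypotenuse (vnorm_ge0 _) (vnorm_ge0 _) (vnorm_oproj_compl L w)).
Qed.

(** * Dimensions *)

Definition perp (z : vec) : space := lker (linfun (mulmxr (z^t* ))).

Lemma mem_perp (z v : vec) : (v \in perp z) = (dotmx v z == 0).
Proof.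
rewrite memv_ker lfunE /= mul_adj; apply/eqP/eqP => [|->]; last exact: raddf0.
by move/matrixP/(_ ord0 ord0); rewrite !mxE mulr1n.
Qed.

Lemma dim_perp_cap (L : space) (z : vec) :
  (\dim L <= (\dim (L :&: perp z)).+1)%N.
Proof.
rewrite -(limg_ker_dim (linfun (mulmxr (z^t* ))) L) -[leqRHS]addn1 leq_add2l.
by rewrite (leq_trans (dimvS (subvf _)))// dimvf.
Qed.

Lemma dim_perp (z : vec) : z != 0 -> (\dim (perp z) <= n)%N.
Proof.
move=> z0; have pzT : perp z != fullv.
  apply: contraNneq z0 => pzT; have := memvf z; rewrite -pzT mem_perp.
  by rewrite dotmx_eq0.
rewrite -ltnS; have := dimv_leqif_eq (subvf (perp z)).
by rewrite dimvf dim_matrix => /ltn_leqif; rewrite mul1r => ->.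
Qed.

Lemma dim_at_least_le (X : set vec) (j k : nat) :
  (j <= k)%N -> dim_at_least X k -> dim_at_least X j.
Proof.
move=> jk [c [irr inc top]]; exists (fun i => c (i + (k - j))%N).
split=> [i ij|i ij|].
- by apply: irr; rewrite -[leqRHS](subnKC jk) leq_add2r.
- by rewrite addSn; apply: inc; rewrite -[ltnRHS](subnKC jk) ltn_add2r.
- by rewrite subnKC.
Qed.

Lemma has_dim_inj (X : set vec) (j k : nat) :
  has_dim X j -> has_dim X k -> j = k.
Proof.
move=> [j1 j2] [k1 k2]; apply/eqP; rewrite eqn_leq.
by apply/andP; split; rewrite leqNgt; apply/negP => /dim_at_least_le; auto.
Qed.

Lemma tangentL_perp (L : space) (z w : vec) :
  tangentL L z w <-> w \in (L :&: perp z)%VS.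
Proof.
rewrite memv_cap mem_perp; split=> [[-> /eqP ->]//|/andP[wL /eqP wz]].
by split.
Qed.

(** Inside the orthogonal complement of [z], of dimension [m + s], the spaces
[tangentZ Z z] and [tangentL L z] have dimensions [m] and at least [s]: if they
meet only in 0, they span it. *)
Lemma not_transversal_meet (Z : set vec) (L : space) (z : vec) m s :
    z != 0 -> n = (m + s)%N -> has_dim Z m -> smooth_point Z z ->
    \dim L = s.+1 -> ~ Defs.transversal Z L z ->
  exists w, [/\ w != 0, tangentZ Z z w & tangentL L z w].
Proof.
move=> z0 nE dimZ [_ [T TE dimT]] dimL ntr.
have dT := has_dim_inj dimT dimZ.
have TP : (T <= perp z)%VS.
  apply/subvP => w wT; have : tangentZ Z z w by rewrite TE.
  by case=> wz _; rewrite mem_perp; apply/eqP.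
have [TL0|TL0] := eqVneq (T :&: (L :&: perp z))%VS 0%VS; last first.
  exists (vpick (T :&: (L :&: perp z))%VS); rewrite vpick0 TL0.
  have := memv_pick (T :&: (L :&: perp z))%VS; rewrite memv_cap => /andP[pT pL].
  by split => //; [rewrite TE|exact/tangentL_perp].
exfalso; apply: ntr.
have sumE : (T + (L :&: perp z))%VS = perp z.
  apply/eqP; rewrite eqEdim subv_add TP capvSr/= dimv_disjoint_sum// dT.
  rewrite (leq_trans (dim_perp z0))// [leqLHS]nE leq_add2l.
  by rewrite -ltnS -dimL dim_perp_cap.
rewrite /Defs.transversal TE; apply/seteqP; split=> [_ [u uT [v vL <-]]|w wz].
  rewrite /tangentP /=; apply/eqP; rewrite -mem_perp -sumE.
  by apply: memv_add => //; apply/tangentL_perp.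
have : w \in (T + (L :&: perp z))%VS by rewrite sumE mem_perp; apply/eqP.
case/memv_addP => u uT [v vL wE]; exists u => //; exists v; last exact: esym.
exact/tangentL_perp.
Qed.

(** * The length of a rotation *)

Section Curve.
Variables (a b a' b' : R -> R).
Hypotheses (da : forall t : R, is_derive t 1 a (a' t))
  (db : forall t : R, is_derive t 1 b (b' t))
  (ca' : continuous a') (cb' : continuous b').

Let comb (V : normedModType R) (v0 v1 v2 : V) (x y : R -> R) t :=
  v0 + x t *: v1 + y t *: v2.

Let derive_comb (V : normedModType R) (v0 v1 v2 : V) (x y x' y' : R -> R)
    (dx : forall t : R, is_derive t 1 x (x' t))
    (dy : forall t : R, is_derive t 1 y (y' t)) (t : R) :
  is_derive t 1 (comb v0 v1 v2 x y) (comb 0 v1 v2 x' y' t).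
Proof.
apply: is_deriveD; last exact: is_derive_scale.
by apply: is_deriveD; exact: is_derive_scale.
Qed.

Variables N0 N1 N2 : mat.
Let M t := N0 + rC (a t) *: N1 + rC (b t) *: N2.

Let re_comb t : re_mx M t =
  comb (N0 ^ @complex.Re R) (N1 ^ @complex.Re R) (N2 ^ @complex.Re R) a b t.
Proof.
apply/matrixP => i j; rewrite !mxE.
case: (N0 i j) (N1 i j) (N2 i j) => [x0 y0] [x1 y1] [x2 y2] /=.
by rewrite !mul0r !subr0.
Qed.

Let im_comb t : im_mx M t =
  comb (N0 ^ @complex.Im R) (N1 ^ @complex.Im R) (N2 ^ @complex.Im R) a b t.
Proof.
apply/matrixP => i j; rewrite !mxE.
case: (N0 i j) (N1 i j) (N2 i j) => [x0 y0] [x1 y1] [x2 y2] /=.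
by rewrite !mul0r !addr0.
Qed.

Let derive1_comb (V : normedModType R) (v0 v1 v2 : V) :
  derive1 (comb v0 v1 v2 a b) = comb 0 v1 v2 a' b'.
Proof.
apply/funext => t; rewrite derive1E.
by have [_] := derive_comb v0 v1 v2 da db t.
Qed.

Let continuous_comb (V : normedModType R) (v1 v2 : V) :
  continuous (comb 0 v1 v2 a' b').
Proof.
move=> t; apply: cvgD; last by apply: cvgZr_tmp; exact: cb'.
by apply: cvgD; [exact: cvg_cst|apply: cvgZr_tmp; exact: ca'].
Qed.

Lemma C1_curve : C1_mx M.
Proof.
rewrite /C1_mx (funext re_comb) (funext im_comb) !derive1_comb.
split; [| |exact: continuous_comb..] => t.
  by have [] := derive_comb (N0 ^ @complex.Re R) (N1 ^ @complex.Re R)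
    (N2 ^ @complex.Re R) da db t.
by have [] := derive_comb (N0 ^ @complex.Im R) (N1 ^ @complex.Im R)
  (N2 ^ @complex.Im R) da db t.
Qed.

Lemma deriv_curve t : deriv_mx M t = rC (a' t) *: N1 + rC (b' t) *: N2.
Proof.
rewrite /deriv_mx (funext re_comb) (funext im_comb) !derive1_comb.
apply/matrixP => i j; rewrite !mxE !add0r.
case: (N1 i j) (N2 i j) => [x1 y1] [x2 y2].
by apply/eqP; rewrite eq_complex /= !mul0r !subr0 !addr0 !eqxx.
Qed.

End Curve.

Lemma d_g_le (L L' : space) (c : R -> space) (l : R) :
  C1_path L L' c -> (forall t, hs_norm (velocity c t) = l) ->
  (d_g L L' <= l%:E)%E.
Proof.
move=> pc vl; apply: ereal_inf_le.
exists (curve_length c)%:E; first by exists c.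
rewrite lee_fin /curve_length (_ : (fun t => _) = cst l); last exact/funext.
rewrite Rintegral_cst//.
have /= -> := lebesgue_measure_itv (`[0, 1] : interval R).
by rewrite lte01 oppr0 adde0 mulr1.
Qed.

Lemma d_gxx (L : space) : (d_g L L <= 0)%E.
Proof.
have const : (fun _ : R => oproj L) =
    (fun t => oproj L + rC (cst 0 t) *: 0 + rC (cst 0 t) *: 0).
  by apply/funext => t; rewrite !scaler0 !addr0.
have d0 (t : R) : is_derive t 1 (cst 0 : R -> R) (cst 0 t).
  exact: is_derive_cst.
have c0 : continuous (cst 0 : R -> R) by exact: cst_continuous.
apply: (@d_g_le _ _ (fun=> L)) => [|t].
  by split => //; rewrite const; exact: (C1_curve d0 d0 c0 c0).
rewrite /velocity const (deriv_curve d0 d0) !scaler0 addr0.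
by rewrite mulmx0 mul0mx /hs_norm mul0mx mxtrace0 /= sqrtr0.
Qed.

(** For a unit vector [e] of [L], this maps [e] to [u] and fixes the part of [L]
orthogonal to [e]; the orthogonal complement of [L] is sent to 0. *)
Definition turn_mx (L : space) (e u : vec) : mat :=
  oproj L - e^t* *m e + e^t* *m u.

Definition turn (L : space) (e u : vec) : space :=
  (linfun (mulmxr (turn_mx L e u)) @: L)%VS.

Section Rotation.
Variables (L : space) (e f : vec) (theta : R).
Hypotheses (eL : e \in L) (fL : forall u, u \in L -> dotmx f u = 0).
Hypotheses (ee : dotmx e e = 1) (ff : dotmx f f = 1).

(** The unit circle from [e] to [f], and its derivative. *)
Definition circle (x : R) : vec := rC (cos x) *: e + rC (sin x) *: f.
Definition circle' (x : R) : vec := rC (- sin x) *: e + rC (cos x) *: f.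

(* The projection to the part of L that does not move. *)
Let P0 := oproj L - e^t* *m e.

Let eP : e *m oproj L = e. Proof. exact: oproj_id. Qed.
Let fP : f *m oproj L = 0. Proof. exact: oproj0. Qed.
Let Pe : oproj L *m e^t* = e^t*.
Proof. by rewrite -[in RHS]eP adjointM oproj_herm. Qed.
Let ee1 : e *m e^t* = 1%:M. Proof. by rewrite mul_adj ee. Qed.
Let ff1 : f *m f^t* = 1%:M. Proof. by rewrite mul_adj ff. Qed.
Let fe0 : f *m e^t* = 0. Proof. by rewrite mul_adj fL// raddf0. Qed.
Let ef0 : e *m f^t* = 0.
Proof. by rewrite -[e]trmxCK -adjointM fe0 trmx0 map_mx0. Qed.

Let eP0 : e *m P0 = 0.
Proof. by rewrite mulmxBr eP mulmxA ee1 mul1mx subrr. Qed.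
Let fP0 : f *m P0 = 0.
Proof. by rewrite mulmxBr fP mulmxA fe0 mul0mx subrr. Qed.
Let P0h : P0^t* = P0.
Proof. by rewrite adjointB oproj_herm adjointM trmxCK. Qed.
Let P0e : P0 *m e^t* = 0.
Proof. by rewrite -P0h -adjointM eP0 trmx0 map_mx0. Qed.
Let PP0 : oproj L *m P0 = P0.
Proof. by rewrite mulmxBr oproj_idem mulmxA Pe. Qed.
Let P0P0 : P0 *m P0 = P0.
Proof. by rewrite {1}/P0 mulmxBl PP0 -mulmxA eP0 mulmx0 subr0. Qed.

Let adj_circle x : (circle x)^t* = rC (cos x) *: e^t* + rC (sin x) *: f^t*.
Proof. by rewrite adjointD !adjointZ !conj_rC. Qed.

Let adj_circle' x : (circle' x)^t* = rC (- sin x) *: e^t* + rC (cos x) *: f^t*.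
Proof. by rewrite adjointD !adjointZ !conj_rC. Qed.

Let frame (a b c d : R) :
  (rC a *: e + rC b *: f) *m (rC c *: e^t* + rC d *: f^t*) =
  (rC (a * c + b * d))%:M.
Proof.
rewrite mulmxDl !mulmxDr -!scalemxAl -!scalemxAr ee1 ff1 ef0 fe0.
rewrite !scaler0 addr0 add0r !scalerA !scalemx1 -raddfD/=.
by rewrite -!rCM -rCD.
Qed.

Lemma circle_circle x : circle x *m (circle x)^t* = 1%:M.
Proof. by rewrite adj_circle frame -!expr2 cos2Dsin2. Qed.

Let circle_circle' x : circle x *m (circle' x)^t* = 0.
Proof. by rewrite adj_circle' frame mulrN mulrC addNr raddf0. Qed.

Let circle'_circle' x : circle' x *m (circle' x)^t* = 1%:M.
Proof. by rewrite adj_circle' frame mulrNN -!expr2 addrC cos2Dsin2. Qed.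

Let circle'_circle x : circle' x *m (circle x)^t* = 0.
Proof.
by rewrite -[circle' x]trmxCK -adjointM circle_circle' trmx0 map_mx0.
Qed.

Let circleP0 x : circle x *m P0 = 0.
Proof. by rewrite mulmxDl -!scalemxAl eP0 fP0 !scaler0 addr0. Qed.
Let circle'P0 x : circle' x *m P0 = 0.
Proof. by rewrite mulmxDl -!scalemxAl eP0 fP0 !scaler0 addr0. Qed.
Let P0circle x : P0 *m (circle x)^t* = 0.
Proof. by rewrite -P0h -adjointM circleP0 trmx0 map_mx0. Qed.
Let P0circle' x : P0 *m (circle' x)^t* = 0.
Proof. by rewrite -P0h -adjointM circle'P0 trmx0 map_mx0. Qed.

Let turn_mxE x : turn_mx L e (circle x) = P0 + e^t* *m circle x.
Proof. by []. Qed.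

Let turn_adj x : (turn_mx L e (circle x))^t* = P0 + (circle x)^t* *m e.
Proof. by rewrite adjointD P0h adjointM trmxCK. Qed.

Let turn_iso x :
  turn_mx L e (circle x) *m (turn_mx L e (circle x))^t* = oproj L.
Proof.
rewrite turn_adj turn_mxE mulmxDl (mulmxDr P0) (mulmxDr (e^t* *m _)) P0P0.
rewrite -!mulmxA [circle x *m P0]circleP0 mulmx0 add0r.
rewrite [P0 *m (_ *m _)]mulmxA P0circle mul0mx addr0.
by rewrite [circle x *m _]mulmxA circle_circle mul1mx subrK.
Qed.

Let turn_P x : oproj L *m turn_mx L e (circle x) = turn_mx L e (circle x).
Proof. by rewrite turn_mxE mulmxDr PP0 mulmxA Pe. Qed.

Lemma dim_turn x : \dim (turn L e (circle x)) = \dim L.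
Proof. exact: dim_isometry_image. Qed.

Let oproj_turn x : oproj (turn L e (circle x)) = P0 + (circle x)^t* *m circle x.
Proof.
rewrite oproj_isometry_image// turn_adj turn_mxE.
rewrite mulmxDl (mulmxDr P0) (mulmxDr (_^t* *m e)) P0P0.
rewrite [P0 *m (_ *m _)]mulmxA P0e mul0mx addr0.
by rewrite -!mulmxA eP0 mulmx0 add0r [e *m _]mulmxA ee1 mul1mx.
Qed.

Lemma turn0 : turn L e e = L.
Proof.
have e0 : circle 0 = e by rewrite /circle cos0 sin0 scale1r scale0r addr0.
apply/eqP; rewrite -[X in turn _ _ X]e0 eqEdim dim_turn leqnn andbT.
apply/subvP => _ /memv_imgP[v vL ->]; rewrite lfunE /= e0.
by rewrite /turn_mx subrK oproj_id.
Qed.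

Let a (t : R) := cos (theta * t) * sin (theta * t).
Let b (t : R) := sin (theta * t) ^+ 2.
Let a' (t : R) := theta * (cos (theta * t) ^+ 2 - sin (theta * t) ^+ 2).
Let b' (t : R) := theta * (2 * sin (theta * t) * cos (theta * t)).

Let oproj_turn_at t : oproj (turn L e (circle (theta * t))) =
  oproj L + rC (a t) *: (e^t* *m f + f^t* *m e)
          + rC (b t) *: (f^t* *m f - e^t* *m e).
Proof.
rewrite oproj_turn adj_circle /P0 -addrA [- _ + _]addrC -addrA; congr (_ + _).
rewrite arc_square; last first.
  by rewrite -!rCM -[1]/(rC 1) -rCB -!expr2 cos2sin2.
by rewrite /a /b expr2 !rCM.
Qed.

Let dlin (t : R) : is_derive t 1 ( *%R theta) theta.
Proof. by rewrite -[X in is_derive _ _ _ X]mulr1; exact: is_deriveZ. Qed.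

Let dcos (t : R) :
  is_derive t 1 (fun t => cos (theta * t)) (- theta * sin (theta * t)).
Proof.
have := is_derive1_comp (is_derive_cos _) (dlin t).
by rewrite [X in is_derive _ _ _ X -> _]mulrC mulrN -mulNr.
Qed.

Let dsin (t : R) :
  is_derive t 1 (fun t => sin (theta * t)) (theta * cos (theta * t)).
Proof.
have := is_derive1_comp (is_derive_sin _) (dlin t).
by rewrite [X in is_derive _ _ _ X -> _]mulrC.
Qed.

Let da (t : R) : is_derive t 1 a (a' t).
Proof.
have := is_deriveM (dcos t) (dsin t).
by rewrite (_ : _ + _ = a' t)// /a' /GRing.scale /=; ring.
Qed.

Let db (t : R) : is_derive t 1 b (b' t).
Proof.
have := is_deriveX 2 (dsin t).
by rewrite (_ : _ *: _ = b' t)// /b' /GRing.scale /=; ring.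
Qed.

Let turn_C1 : C1_mx (fun t => oproj (turn L e (circle (theta * t)))).
Proof.
have ccos : continuous (fun t => cos (theta * t)).
  move=> t; apply: differentiable_continuous; apply/derivable1_diffP.
  by have [] := dcos t.
have csin : continuous (fun t => sin (theta * t)).
  move=> t; apply: differentiable_continuous; apply/derivable1_diffP.
  by have [] := dsin t.
rewrite (funext oproj_turn_at); apply: (C1_curve da db) => t.
  apply: cvgM; first exact: cvg_cst.
  by apply: cvgB; apply: cvgM; try exact: ccos; exact: csin.
apply: cvgM; first exact: cvg_cst.
apply: cvgM; last exact: ccos.
by apply: cvgM; [exact: cvg_cst|exact: csin].
Qed.

Let deriv_turn (t : R) :
  deriv_mx (fun t => oproj (turn L e (circle (theta * t)))) t =
  rC theta *: ((circle' (theta * t))^t* *m circle (theta * t) +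
               (circle (theta * t))^t* *m circle' (theta * t)).
Proof.
rewrite (funext oproj_turn_at) (deriv_curve da db).
have := arc_leibniz e f (e^t* ) (f^t* )
  (rC (cos (theta * t))) (rC (sin (theta * t))).
rewrite -rCN -adj_circle -adj_circle' -/(circle _) -/(circle' _) => ->.
rewrite [in RHS]scalerDr !scalerA.
have two : 2 = rC 2 by rewrite (rmorph_nat (real_complex R) 2).
by rewrite two -!rCM -rCB -!rCM -!expr2.
Qed.

Let velocity_turn t : velocity (fun t => turn L e (circle (theta * t))) t =
  rC theta *: ((circle (theta * t))^t* *m circle' (theta * t)).
Proof.
rewrite /velocity deriv_turn oproj_turn -scalemxAr -scalemxAl.
set x := theta * t; apply: (congr1 (fun X : mat => rC theta *: X)).
exact: (rank_one_velocity (P0circle x) (P0circle' x) (circle'P0 x)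
  (circle_circle x) (circle_circle' x) (circle'_circle x)).
Qed.

(** The rotation has constant speed [theta]: its velocity is the map of rank one
from the unit vector [circle] to the unit vector [circle'], times [theta]. *)
Lemma d_g_turn :
  0 <= theta -> (d_g L (turn L e (circle theta)) <= theta%:E)%E.
Proof.
move=> theta0.
apply: (@d_g_le _ _ (fun t => turn L e (circle (theta * t)))) => [|t].
  split; [by move=> t; exact: dim_turn|exact: turn_C1| |by rewrite mulr1].
  by rewrite mulr0 /circle cos0 sin0 scale1r scale0r addr0 turn0.
rewrite /hs_norm velocity_turn; set u := circle _; set u' := circle' _.
rewrite adjointZ conj_rC adjointM trmxCK -scalemxAl -scalemxAr scalerA -mulmxA.
rewrite [u' *m _]mulmxA circle'_circle' mul1mx linearZ /= mxtrace_mulC.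
rewrite circle_circle mxtrace1.
by rewrite mulr1 -rCM /= -expr2 sqrtr_sqr ger0_norm.
Qed.

End Rotation.

Lemma rotate_in_plane (L : space) (z e f : vec) (a b k : R) :
    z \in L -> e \in L -> (forall u, u \in L -> dotmx f u = 0) ->
    dotmx e e = 1 -> dotmx f f = 1 -> dotmx e z = 0 ->
    0 <= a -> 0 <= b -> 0 < k -> k ^+ 2 = a ^+ 2 + b ^+ 2 ->
  exists L' : space, [/\ \dim L' = \dim L, z \in L',
    rC a *: e + rC b *: f \in L' & (d_g L L' <= (asin (b / k))%:E)%E].
Proof.
move=> zL eL fL ee ff ez a0 b0 k0 k2.
have x0 : 0 <= b / k by rewrite divr_ge0// ltW.
have x1 : b / k <= 1.
  by rewrite ler_pdivrMr// mul1r; exact: leg_le_hypotenuse (ltW k0) k2.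
have xI : -1 <= b / k <= 1 by rewrite x1 (le_trans _ x0)// lerN10.
have sint : sin (asin (b / k)) = b / k by rewrite asinK// in_itv.
have cost : cos (asin (b / k)) = a / k.
  rewrite cos_asin// -[RHS]ger0_norm ?divr_ge0 ?(ltW k0)// -sqrtr_sqr.
  congr Num.sqrt; rewrite !expr_div_n k2.
  by field; rewrite -k2 expf_neq0 ?gt_eqF.
have : 0 <= asin (b / k) by rewrite asin_ge0// x0.
move: (asin (b / k)) sint cost => t sint cost t0.
have wE : rC a *: e + rC b *: f = rC k *: circle e f t.
  have divk c : c = k * (c / k) by rewrite mulrC divfK ?gt_eqF.
  by rewrite /circle sint cost scalerDr !scalerA -!rCM -!divk.
exists (turn L e (circle e f t)); split.
- exact: dim_turn.
- apply/memv_imgP; exists z => //; rewrite lfunE /= /turn_mx.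
  have ze : z *m e^t* = 0 by rewrite mul_adj dotmxC ez !raddf0.
  by rewrite mulmxDr mulmxBr oproj_id// !mulmxA ze !mul0mx subr0 addr0.
- rewrite wE; apply: memvZ; apply/memv_imgP; exists e => //.
  rewrite lfunE /= /turn_mx mulmxDr mulmxBr oproj_id// (mulmxA e).
  by rewrite mul_adj ee mul1mx subrr add0r mulmxA mul_adj ee mul1mx.
- exact: d_g_turn.
Qed.

(** The rotation takes the direction [e] of the projection of [w] to [L] to the
direction of [w].  It fixes [z], which is in [L] and orthogonal to [e].  When
[w] is orthogonal to [L], any unit vector of [L] orthogonal to [z] can serve as
[e]; there is one as [L] has dimension at least 2. *)
Lemma rotate_into (L : space) (z w : vec) :
    (1 < \dim L)%N -> z \in L -> w != 0 -> dotmx w z = 0 ->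
  exists L' : space, [/\ \dim L' = \dim L, z \in L', w \in L' &
    (d_g L L' <= (asin (vnorm (w - w *m oproj L) / vnorm w))%:E)%E].
Proof.
move=> dL zL w0 wz; set l := w *m oproj L; set p := w - l.
have lL : l \in L by exact: oproj_mem.
have lz : dotmx l z = 0 by rewrite dotmx_mull oproj_herm oproj_id.
have pL u : u \in L -> dotmx p u = 0 by exact: oproj_orth.
have [p0|p0] := eqVneq p 0.
  exists L; split=> //; first by move/eqP: p0; rewrite subr_eq0 => /eqP ->.
  rewrite p0 vnorm0 mul0r -[X in asin X]sin0 sinK; first exact: d_gxx.
  by rewrite in_itv/= oppr_le0 divr_ge0 ?pi_ge0.
have [e [eL ez ee le]] : exists e, [/\ e \in L, dotmx e z = 0, dotmx e e = 1 &
    rC (vnorm l) *: e = l].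
  have [l0|l0] := eqVneq l 0; last first.
    exists (normalize l); split; [exact: memvZ|exact: dotmx_normalize0|
      exact: dotmx_normalize|exact: normalizeK].
  have : (L :&: perp z)%VS != 0%VS.
    by rewrite -dimv_eq0 -lt0n -ltnS (leq_trans dL)// dim_perp_cap.
  rewrite -vpick0; set v := vpick _ => v0.
  have := memv_pick (L :&: perp z)%VS; rewrite -/v memv_cap mem_perp.
  move=> /andP[vL /eqP vz]; exists (normalize v).
  split; [exact: memvZ|exact: dotmx_normalize0|exact: dotmx_normalize|].
  by rewrite l0 vnorm0 scale0r.
have ff : dotmx (normalize p) (normalize p) = 1 by exact: dotmx_normalize.
have fL u : u \in L -> dotmx (normalize p) u = 0.
  by move=> uL; exact/dotmx_normalize0/pL.
have [L' [dL' zL' wL' dLL']] := rotate_in_plane zL eL fL ee ff ez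
  (vnorm_ge0 l) (vnorm_ge0 p) (vnorm_gt0 w0) (vnorm_oproj_compl L w).
exists L'; split=> //.
have lp : l + p = w by rewrite addrC subrK.
have wE := etrans (congr2 +%R le (normalizeK p0)) lp.
by move: wL'; rewrite wE.
Qed.

(** * The derivative of the solution map *)

Lemma translate0 (L : space) : translate L 0 = L.
Proof.
apply/vspaceP => v; apply/memv_imgP/idP => [[u uL ->]|vL].
  by rewrite lfunE /= addr0 mulmx1.
by exists v => //; rewrite lfunE /= addr0 mulmx1.
Qed.

Section SolutionMap.
Variables (Z : set vec) (L : space) (z : vec) (gamma : space -> vec).
Hypothesis sol : solution_map Z L z gamma.
Variable A : mat.

Let curve (h : C) : vec := gamma (translate L (h *: A)).
Let g : vec := 'd (fun B : mat => gamma (translate L B)) (0 : mat) A.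

Let curve0 : curve 0 = z.
Proof.
by case: sol => U [V [_ _ _ _ <-]]; rewrite /curve scale0r translate0.
Qed.

Let dcurve : is_derive (0 : C) 1 curve g.
Proof.
case: sol => U [V [[_ UL] _ _ dF _]].
have := dF L UL; exact: is_derive_ray.
Qed.

Let near_curve : \forall h \near (0 : C),
  (curve h \in translate L (h *: A)) /\ Z (curve h).
Proof.
case: sol => U [V [[Uopen UL] [[_ [W _ VW]] _] UV _ _]].
have [_ nU] := Uopen L UL.
have nU' : \forall h \near (0 : C), U (translate L (h *: A)).
  have sA : (fun h : C => h *: A) @ (0 : C) --> (0 : mat).
    by rewrite -[X in _ --> X](scale0r A); exact: scalel_continuous.
  exact: sA nU.
near=> h; have Uh : U (translate L (h *: A)) by near: h.
have : [set v | V v /\ v \in translate L (h *: A)] (curve h).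
  by rewrite UV//; exists 1; [exact: oner_neq0|rewrite scale1r].
by case=> Vc Lc; split => //; move: Vc; rewrite VW => -[].
Unshelve. all: by end_near. Qed.

(** The open set [V] of the solution map contains the nonzero multiples of [z];
thus [z] itself is a direction along which the equations of [Z] vanish. *)
Lemma cone_near_solution : \forall h \near (0 : C), Z ((1 + h) *: z).
Proof.
case: sol => U [V [[Uopen UL] [[Vcone [W _ VW]] Vz] UV _ _]].
by apply: filterS (near_1D_neq0 C) => h /(Vcone _ z)/(_ Vz); rewrite VW => -[].
Qed.

(** The derivative [g] of the solution along [A] is tangent to the cone over
[Z], as [z] is; projecting [g] orthogonally to [z] subtracts a multiple of
[z]. *)
Lemma D_solution_tangent : tangentZ Z z (D_solution L z gamma A).
Proof.
split=> [|f fhom fZ].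
  rewrite /tangentP /= /D_solution /to_tangentP -/g linearBl/= linearZl_LR/=.
  have [->|z0] := eqVneq z 0; first by rewrite !linear0r subrr.
  by rewrite divfK ?subrr// dotmx_eq0.
have grad_g : \sum_(i < n.+1) meval (z ord0) (mderiv i f) * g ord0 i = 0.
  rewrite -curve0; apply: (@gradient_along_zeros C n.+1
    (fun i h => curve h ord0 i) (fun i => g ord0 i)).
    by move=> i; exact: is_derive_coord.
  by apply: filterS near_curve => h [_ /fZ].
have grad_z : \sum_(i < n.+1) meval (z ord0) (mderiv i f) * z ord0 i = 0.
  have d (i : 'I_n.+1) : is_derive (0 : C) 1
      (fun h : C => z ord0 i + h * z ord0 i) (z ord0 i).
    exact: is_derive_affine.
  have := gradient_along_zeros d (f := f).
  rewrite (_ : (fun i => _) = z ord0); last first.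
    by apply/funext => i; rewrite mul0r addr0.
  apply; apply: filterS cone_near_solution => h /fZ.
  rewrite (_ : (_ *: z) ord0 = (fun i => z ord0 i + h * z ord0 i))//.
  by apply/funext => i; rewrite mxE mulrDl mul1r.
rewrite /D_solution /to_tangentP -/g.
under eq_bigr do rewrite !mxE mulrBr mulrCA.
by rewrite sumrB grad_g -mulr_sumr grad_z mulr0 subr0.
Qed.

(** Since [A] vanishes on the orthogonal complement of [L] and maps into it,
[A *m A = 0].  Therefore a point [c = v *m (1 + h A)] of the translate of [L],
with [v] in [L], satisfies [c *m (1 - P) = h *: (c *m A)] for the projection [P]
to [L].  This equation, differentiated at [h = 0], is the claim. *)
Lemma D_solution_normal : tangentG L A -> z \in L ->
  D_solution L z gamma A - D_solution L z gamma A *m oproj L = z *m A.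
Proof.
move=> [A0 AL] zL; set P := oproj L.
have AP (v : vec) : v *m A *m P = 0 by apply: oproj0 => u; exact: AL.
have AA (v : vec) : v *m A *m A = 0 by apply: A0 => u; exact: AL.
have PA (v : vec) : v *m P *m A = v *m A.
  apply/eqP; rewrite eq_sym -subr_eq0 -mulmxBl; apply/eqP/A0 => u.
  exact: oproj_orth.
have gA : g *m (1%:M - P) = z *m A.
  apply/rowP => j; apply/eqP; rewrite -subr_eq0; apply/eqP.
  have d1 := is_derive_mulmx_coord (1%:M - P) j dcurve.
  have d2 := is_deriveM (is_derive_id (0 : C) 1)
    (is_derive_mulmx_coord A j dcurve).
  have := is_derive_zero (is_deriveB d1 d2).
  rewrite curve0 scale0r add0r /GRing.scale/= mulr1; apply.
  apply: filterS near_curve => h [/memv_imgP[v vL]]; rewrite lfunE /= => ch _.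
  have cE : curve h = v + h *: (v *m A) by rewrite ch mulmxDr mulmx1 scalemxAr.
  rewrite -[LHS]/((curve h *m (1%:M - P)) ord0 j
    - h * (curve h *m A) ord0 j) cE.
  rewrite mulmxBr mulmx1 !mulmxDl -!scalemxAl AP AA oproj_id// !scaler0 !addr0.
  by rewrite addrAC subrr add0r mxE subrr.
rewrite /D_solution /to_tangentP -/g mulmxBl -scalemxAl (oproj_id zL).
by rewrite opprB addrA subrK -gA mulmxBr mulmx1.
Qed.

End SolutionMap.

End ProjectiveGeometry.

(** * The inclusion *)

Theorem corollary1p10 (R : realType) (n m s : nat) (m_gt0 : (0 < m)%N)
    (m_lt_n : (m < n)%N) (s_def : s = (n - m)%N)
    (Z : set 'rV[Cplx R]_n.+1) (Z_irr : irreducible_variety Z)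
    (Z_dim : has_dim Z m)
    (eps : R) (eps_gt0 : 0 < eps) (eps_le1 : eps <= 1) :
  [set L | Grass s L /\ ((eps^-1)%:E <= kappa s Z L)%E] `<=`
  tube s (Hurwitz s Z) eps `|` Irrel s Z.
Proof.
move=> L [GL]; rewrite /kappa; case: asboolP => [iL _|niL kL]; first by right.
left; split=> //; rewrite leNgt; apply/negP => dfar.
have Hur z L' : smooth_point Z z -> Schubert s Z z L' ->
    (d_g_set L (Hurwitz s Z) <= d_g L L')%E.
  move=> sz SL'; apply: ereal_inf_lbound; exists L' => // Y [_]; apply.
  by exists z.
have [c [c0 ceps cx]] := asin_gap eps_gt0 eps_le1 dfar.
have dL : (1 < \dim L)%N by rewrite GL s_def ltnS subn_gt0.
move: kL; apply/negP; rewrite -ltNge; apply: (@le_lt_trans _ _ c%:E);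
  last first.
  by rewrite lte_fin.
apply: ge_ereal_sup => _ [z [Zz zL] <-].
have z0 : z != 0.
  (* The condition in zeros is on the coordinate function of z. *)
  case: Z_irr => -[F _ ZF] _ _.
  have [nz _] : zeros F z by rewrite -ZF; exact: Zz.
  apply: contraNneq nz => ->; apply/eqP.
  by apply/funext => i; apply/funext => j; rewrite mxE.
have sz : smooth_point Z z.
  apply: contrapT => nsz; apply: niL; split; first exact: GL.
  by left; exists z.
rewrite /kappa_at; case: asboolP => [[_ _]|ntr]; last first.
  have [||w [w0 wZ wL]] := @not_transversal_meet R n Z L z m s z0 _ Z_dim sz GL.
  - by rewrite s_def subnKC// ltnW.
  - by move=> tr; apply: ntr.
  have SL : Schubert s Z z L by split => //; exists w.
  have := lt_le_trans dfar (le_trans (Hur z L sz SL) (d_gxx L)).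
  by rewrite lte_fin ltNge asin_ge0// (ltW eps_gt0).
apply: ge_ereal_sup => _ [gamma sol <-].
apply: ge_ereal_sup => _ [A [tA A1] <-]; rewrite lee_fin.
set w := D_solution L z gamma A.
have [->|w0] := eqVneq w 0; first by rewrite /fs_norm vnorm0 mul0r.
have wZ : tangentZ Z z w by exact: (D_solution_tangent sol).
have [L' [dL' zL' wL' dLL']] := rotate_into dL zL w0 wZ.1.
have SL' : Schubert s Z z L'.
  split=> //; first by rewrite /Grass /= dL'.
  by exists w; split => //; split => //; exact: wZ.1.
have dw := le_trans (Hur z L' sz SL') dLL'.
have x1 := vnorm_oproj_compl_le L w.
have normal : w - w *m oproj L = z *m A := D_solution_normal sol tA zL.
have zA : vnorm (z *m A) <= vnorm z.
  exact: le_trans (vnorm_mulmx z A) (ler_piMr (vnorm_ge0 z) A1).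
rewrite normal in dw x1; have nw := vnorm_gt0 w0.
apply: (ler_ratio nw (vnorm_gt0 z0) c0 zA); apply: cx dw.
by rewrite (divr_ge0 (vnorm_ge0 _) (ltW nw)) (ler_pdivrMr _ _ nw) mul1r.
Qed.
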